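(* Let $n \geq 2$ be any integer. (i) The identities \[ x^{n+1}a \approx xa, \qquad x^{m_1}y^{m_2} \approx y^{m_2}x^{m_1}\ \ (m_1,m_2 \geq 2), \qquad xya \approx yxa \] constitute an identity basis for the variety $\operatorname{var}\{J,\mathbb{Z}_n\}$ of semigroups. (ii) The identities \[ x^{n+1}a \approx xa, \qquad x^2y^2 \approx y^2x^2, \qquad xya \approx yxa \] also constitute an identity basis for the variety $\operatorname{var}\{J,\mathbb{Z}_n\}$.
   Context: All varieties are varieties of semigroups, and all identities are semigroup identities; associativity is always assumed. For semigroups $S,T$, $\operatorname{var}\{S,T\}$ denotes the variety generated by $S$ and $T$, i.e. the smallest class of semigroups containing $S$ and $T$ and closed under homomorphic images, subsemigroups, and arbitrary direct products. An identity basis for a variety $\mathbf{V}$ is a set of identities satisfied by $\mathbf{V}$ from which every identity satisfied by $\mathbf{V}$ can be deduced. $J$ is the semigroup on $\{1,2,3\}$ whose Cayley table has rows $111$, $111$, $123$ (row $i$, column $j$ gives $i\cdot j$); equivalently $J=\{0,a,e\}$ with zero $0$ and $e^2=e$, $ea=a$, $ae=0$, $a^2=0$. $\mathbb{Z}_n$ is the cyclic group of order $n$ regarded as a semigroup. *)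

(* Defs.v *)
From HB Require Import structures.
From mathcomp Require Import all_boot all_algebra.
From mathcomp Require Import boolp.

Set Implicit Arguments.
Unset Strict Implicit.
Unset Printing Implicit Defensive.

Local Open Scope group_scope.

(* Varieties of semigroups.  The choice structure carried by a [semigroupType]
   is immaterial: every type has one (boolp), and a variety, being closed under
   isomorphic images, does not depend on which one is used. *)

Definition homomorphism (S T : semigroupType) (f : S -> T) : Prop :=
  {morph f : x y / x * y >-> x * y}.

Section DirectProduct.
Variables (I : Type) (F : I -> semigroupType).

Definition semigroup_prod_mul (f g : forall i, F i) : forall i, F i :=
  fun i => f i * g i.

Lemma semigroup_prod_mulA : associative semigroup_prod_mul.
Proof. by move=> f g h; apply: functional_extensionality_dep => i; apply: mulgA. Qed.

HB.instance Definition _ := isSemigroup.Build (forall i, F i) semigroup_prod_mulA.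

Definition semigroup_prod : semigroupType := forall i, F i.
End DirectProduct.

Record variety (V : semigroupType -> Prop) : Prop := Variety {
  variety_image : forall (S T : semigroupType) (f : S -> T),
    homomorphism f -> (forall y, exists x, f x = y) -> V S -> V T;
  variety_sub : forall (S T : semigroupType) (f : S -> T),
    homomorphism f -> injective f -> V T -> V S;
  variety_prod : forall (I : Type) (F : I -> semigroupType),
    (forall i, V (F i)) -> V (semigroup_prod F)
}.

Definition var2 (S T : semigroupType) : semigroupType -> Prop :=
  fun U => forall V, variety V -> V S -> V T -> V U.

(* Words: the free semigroup over the countably infinite alphabet [nat]. *)

Record word := Word { letters :> seq nat; letters_neq0 : letters != [::] }.

HB.instance Definition _ := [isSub for letters].
HB.instance Definition _ := [Choice of word by <:].

Lemma word_mul_subproof (u v : word) : letters u ++ letters v != [::].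
Proof. by case: u => [[]]. Qed.

Definition word_mul (u v : word) : word := Word (word_mul_subproof u v).

Lemma word_mulA : associative word_mul.
Proof. by move=> u v w; apply/val_inj/catA. Qed.

HB.instance Definition _ := isSemigroup.Build word word_mulA.

Definition letter (i : nat) : word := @Word [:: i] isT.

(* The power [x ^ m] for [1 <= m]; a semigroup has no [x ^ 0], and the value at
   [m = 0] is the junk value [x]. *)
Definition spow (S : semigroupType) (x : S) (m : nat) : S := iterop m *%g x x.

Definition identity : Type := (word * word)%type.

(* Assignments of elements of [S] to the letters are the same as homomorphisms
   from the free semigroup to [S]. *)
Definition satisfies (S : semigroupType) (e : identity) : Prop :=
  forall h : word -> S, homomorphism h -> h e.1 = h e.2.

Definition variety_satisfies (V : semigroupType -> Prop) (e : identity) : Prop :=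
  forall S, V S -> satisfies S e.

(* Birkhoff's rules of equational logic; associativity is built into words. *)
Inductive deducible (B : identity -> Prop) : word -> word -> Prop :=
| ded_axiom u v : B (u, v) -> deducible B u v
| ded_refl u : deducible B u u
| ded_sym u v : deducible B u v -> deducible B v u
| ded_trans u v w : deducible B u v -> deducible B v w -> deducible B u w
| ded_mul u v u' v' :
    deducible B u v -> deducible B u' v' -> deducible B (u * u') (v * v')
| ded_subst (s : word -> word) u v :
    homomorphism s -> deducible B u v -> deducible B (s u) (s v).

Definition identity_basis
    (B : identity -> Prop) (V : semigroupType -> Prop) : Prop :=
  (forall e, B e -> variety_satisfies V e) /\
  (forall e, variety_satisfies V e -> deducible B e.1 e.2).

(* The semigroup J; [J1], [J2], [J3] are the elements 1, 2, 3
   (that is, [0], [a], [e]). *)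

Inductive J := J1 | J2 | J3.

Definition J_encode (i : J) : option bool :=
  match i with J1 => None | J2 => Some false | J3 => Some true end.
Definition J_decode (o : option bool) : J :=
  match o with None => J1 | Some false => J2 | Some true => J3 end.
Lemma J_encodeK : cancel J_encode J_decode. Proof. by case. Qed.
HB.instance Definition _ := Choice.copy J (can_type J_encodeK).

Definition J_mul (i j : J) : J :=
  match i, j with
  | J1, J1 => J1 | J1, J2 => J1 | J1, J3 => J1
  | J2, J1 => J1 | J2, J2 => J1 | J2, J3 => J1
  | J3, J1 => J1 | J3, J2 => J2 | J3, J3 => J3
  end.

Lemma J_mulA : associative J_mul. Proof. by do 3!case. Qed.

HB.instance Definition _ := isSemigroup.Build J J_mulA.

(* The additive group of integers modulo [n], for [1 < n]. *)
Definition Zmod_semigroup (n : nat) : semigroupType := Algebra.to_multiplicative 'Z_n.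

Local Notation x := (letter 0).
Local Notation y := (letter 1).
Local Notation a := (letter 2).

Inductive identities_i (n : nat) : identity -> Prop :=
| identities_i_1 : identities_i n (spow x n.+1 * a, x * a)
| identities_i_2 m1 m2 : 2 <= m1 -> 2 <= m2 ->
    identities_i n (spow x m1 * spow y m2, spow y m2 * spow x m1)
| identities_i_3 : identities_i n (x * y * a, y * x * a).

Inductive identities_ii (n : nat) : identity -> Prop :=
| identities_ii_1 : identities_ii n (spow x n.+1 * a, x * a)
| identities_ii_2 :
    identities_ii n (spow x 2 * spow y 2, spow y 2 * spow x 2)
| identities_ii_3 : identities_ii n (x * y * a, y * x * a).

(* Main.v *)
Require Import Defs.
From mathcomp Require Import all_boot all_algebra.
From mathcomp Require Import boolp zify.

(* Soundness is checked in the two generators.  For completeness, [J] detects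
   the content of a word and its last letter when that letter occurs only once,
   and [Z_n] detects the numbers of occurrences modulo [n].  Conversely, the
   identities allow all letters but the last to be permuted, and [n] further
   copies of any of these letters to be inserted; so two words with the same
   last letter and the same invariants are deducible from each other.  If the
   last letters [s] and [t] differ, neither is the only occurrence of its
   letter, so a word can be brought to the form [p t t s s], whose last four
   letters are turned into [s s t t] by [x^2 y^2 = y^2 x^2]. *)

Set Implicit Arguments.
Unset Strict Implicit.
Unset Printing Implicit Defensive.

Local Open Scope group_scope.

Local Arguments spow : simpl never.

(** * Powers, words and prefixes *)

Lemma spowS (S : semigroupType) (x : S) m : spow x m.+2 = x * spow x m.+1.
Proof. by []. Qed.

Lemma homomorphism_spow (S T : semigroupType) (f : S -> T) x m :
  homomorphism f -> f (spow x m) = spow (f x) m.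
Proof.
move=> fM; case: m => [//|m]; elim: m => [//|m IHm].
by rewrite !spowS fM IHm.
Qed.

Lemma letters_mul (u v : word) : letters (u * v) = letters u ++ letters v.
Proof. by []. Qed.

(** Words are nonempty, so a possibly empty prefix is kept as a list acting on words from the
    left. *)
Definition prefix_mul (p : seq nat) (w : word) : word :=
  foldr (fun i z => letter i * z) w p.

Lemma letters_prefix_mul p w : letters (prefix_mul p w) = p ++ letters w.
Proof. by elim: p => //= i p <-. Qed.

Lemma prefix_mul_cat p q w :
  prefix_mul (p ++ q) w = prefix_mul p (prefix_mul q w).
Proof. exact: foldr_cat. Qed.

Lemma word_lastP (u : word) : exists p s, u = prefix_mul p (letter s).
Proof.
have: letters u != [::] := letters_neq0 u.
case/lastP E: (letters u) => [//|p s] _; exists p, s; apply: val_inj => /=.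
by rewrite letters_prefix_mul cats1.
Qed.

(** * Evaluation of words and satisfaction in a generated variety *)

Section Evaluation.
Variables (S : semigroupType) (phi : nat -> S).

(** Folding from the second letter on avoids a unit, which [S] need not have; the value [phi 0] is
    never reached, since words are nonempty. *)
Definition eval (w : word) : S :=
  if letters w is i :: s then foldl (fun z j => z * phi j) (phi i) s else phi 0.

Lemma eval_letter i : eval (letter i) = phi i. Proof. by []. Qed.

Lemma eval_homomorphism : homomorphism eval.
Proof.
case=> [[//|i s] us] [[//|j t] vt]; rewrite /eval letters_mul /= foldl_cat /=.
set z := foldl _ _ s; elim/last_ind: t {vt} => [//|t k IHt].
by rewrite !foldl_rcons IHt mulgA.
Qed.

Lemma homomorphism_eval h :
  homomorphism h -> (forall i, h (letter i) = phi i) -> h =1 eval.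
Proof.
move=> hM hphi w; have [p [s ->]] := word_lastP w.
by elim: p => [|i p IHp] /=; rewrite ?hM ?eval_homomorphism ?IHp hphi.
Qed.
End Evaluation.

(** For an image, an assignment is lifted letter by letter along the surjection; for subsemigroups
    and products it is composed with the embedding or the projections. *)
Lemma satisfies_variety e : variety (satisfies^~ e).
Proof.
split=> [S T f fM f_onto Se h hM | S T f fM f_inj Te h hM | I F Fe h hM].
- have [phi phiE] := choice (fun i => f_onto (h (letter i))).
  have hE: h =1 f \o eval phi.
    move=> w; rewrite (homomorphism_eval hM (fun=> erefl)) /=.
    apply/esym/(@homomorphism_eval _ _ (f \o eval phi)) => [u v|i] /=.
      by rewrite eval_homomorphism fM.
    by rewrite eval_letter.
  by rewrite !hE /= (Se _ (@eval_homomorphism _ phi)).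
- apply: f_inj; apply: (Te (f \o h)) => u v /=.
  by rewrite hM fM.
- apply: functional_extensionality_dep => i.
  by apply: (Fe i (fun w => h w i)) => u v /=; rewrite hM.
Qed.

Lemma var2_satisfies S T e :
  variety_satisfies (var2 S T) e <-> satisfies S e /\ satisfies T e.
Proof.
split=> [VST | [Se Te] U VU]; first by split; apply: VST => V.
exact: (VU _ (satisfies_variety e)).
Qed.

(** * Soundness in the two generators, and the invariants they detect *)

Lemma spow_J x m : 2 <= m -> spow x m = if x is J3 then J3 else J1.
Proof.
case: m => [|[|m]] // _; elim: m => [|m IHm]; first by case: x.
by rewrite spowS IHm; case: (x).
Qed.

Lemma spow_Zmod n (x : Zmod_semigroup n) m :
  0 < m -> spow x m = ((x : 'Z_n) *+ m)%R :> 'Z_n.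
Proof.
case: m => [//|m] _; elim: m => [//|m IHm].
by rewrite spowS (GRing.mulrS (x : 'Z_n) m.+1) -IHm.
Qed.

Lemma Zmod_semigroupC n (x y : Zmod_semigroup n) : x * y = y * x.
Proof. exact: GRing.addrC. Qed.

Lemma satisfies_J_identities n e : 2 <= n -> identities_i n e -> satisfies J e.
Proof.
move=> n_ge2 [|m1 m2 m1_ge2 m2_ge2|] h hM;
  rewrite /= !hM ?(homomorphism_spow _ _ hM).
- by rewrite spow_J 1?leqW //; do 2!case: (h _).
- by rewrite !spow_J //; do 2!case: (h _).
- by do 3!case: (h _).
Qed.

Lemma satisfies_Zmod_identities n e :
  2 <= n -> identities_i n e -> satisfies (Zmod_semigroup n) e.
Proof.
move=> n_ge2 [|m1 m2 m1_ge2 m2_ge2|] h hM;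
  rewrite /= !hM ?(homomorphism_spow _ _ hM).
- congr (_ * _); rewrite spow_Zmod // GRing.mulrS.
  by rewrite -GRing.mulr_natr pchar_Zp // GRing.mulr0 GRing.addr0.
- exact: Zmod_semigroupC.
- by rewrite (Zmod_semigroupC (h _)).
Qed.

(* The value of a word in [J] when [x] is sent to [a] and all other letters to
   [e]. *)
Definition J_test (x : nat) (w : word) : J :=
  if x \notin letters w then J3
  else if (count_mem x w == 1%N) && (last 0 w == x) then J2 else J1.

(** The value [J2] arises only as [J3 * J2]: the left factor must avoid [x], and the right one must
    end in its only occurrence of [x]. *)
Lemma J_test_homomorphism x : homomorphism (J_test x).
Proof.
move=> u v; rewrite /J_test letters_mul mem_cat negb_or count_cat last_cat.
have [xu|xu] := boolP (x \in letters u) => /=; last first.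
  rewrite (count_memPn xu) add0n.
  have -> : last (last 0 u) v = last 0 v by case: v => [[]].
  by have [xv|xv] := boolP (x \in letters v) => //=; case: ifP.
have: 0 < count_mem x u by rewrite -has_count has_pred1.
have [xv|xv] := boolP (x \in letters v).
  have: 0 < count_mem x v by rewrite -has_count has_pred1.
  move=> cu cv; have -> : (count_mem x u + count_mem x v == 1)%N = false by lia.
  by do 2!case: ifP.
have -> : (last (last 0 u) v == x) = false.
  case: v xv => [[//|j t] vt] /= xv; apply: contraNF xv => /eqP <-.
  exact: mem_last.
by rewrite andbF; case: ifP.
Qed.

Lemma satisfies_J_mem u v x :
  satisfies J (u, v) -> (x \in letters u) = (x \in letters v).
Proof.
move/(_ _ (@J_test_homomorphism x)); rewrite /J_test /=.
by case: (x \in letters u); case: (x \in letters v) => //=; case: ifP.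
Qed.

(** The condition on either side says that [J_test x] takes the value [J2]. *)
Lemma satisfies_J_last u v x : satisfies J (u, v) ->
  (count_mem x u == 1%N) && (last 0 u == x) =
  (count_mem x v == 1%N) && (last 0 v == x).
Proof.
move=> Juv; have := Juv _ (@J_test_homomorphism x); rewrite /J_test /=.
rewrite -(satisfies_J_mem x Juv); have [xu|xu] := boolP (x \in letters u) => /=.
  by case: ifP; case: ifP.
move=> _; rewrite (count_memPn xu).
by rewrite (satisfies_J_mem x Juv) in xu; rewrite (count_memPn xu).
Qed.

Lemma satisfies_Zmod_count n u v x : 2 <= n ->
  satisfies (Zmod_semigroup n) (u, v) ->
  count_mem x u = count_mem x v %[mod n].
Proof.
move=> n_ge2.
pose h (w : word) : Zmod_semigroup n := (count_mem x w)%:R%R : 'Z_n.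
have hM : homomorphism h.
  by move=> w w'; rewrite /h letters_mul count_cat GRing.natrD.
move/(_ h hM)/(congr1 (fun z : 'Z_n => nat_of_ord z)).
by rewrite /h /= !val_Zp_nat.
Qed.

(** * Deducibility and rewriting of prefixes *)

Lemma deducible_mono (A B : identity -> Prop) u v :
  (forall e, A e -> B e) -> deducible A u v -> deducible B u v.
Proof.
move=> AB; elim=> {u v}.
- by move=> u v /AB; apply: ded_axiom.
- exact: ded_refl.
- by move=> u v _; apply: ded_sym.
- by move=> u v w _ uv _; apply: ded_trans uv.
- by move=> u v u' v' _ uv _; apply: ded_mul.
- by move=> s u v sM _; apply: ded_subst.
Qed.

Lemma deducible_instance B u v (phi : nat -> word) :
  B (u, v) -> deducible B (eval phi u) (eval phi v).
Proof.
by move=> Buv; apply: ded_subst (ded_axiom Buv); apply: eval_homomorphism.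
Qed.

(** The word [w] is nonempty, so it can serve as the right factor [a] in the first and third
    identities. *)
Definition prefix_equiv B p q :=
  forall w, deducible B (prefix_mul p w) (prefix_mul q w).

Section PrefixEquivalence.
Variable B : identity -> Prop.
Implicit Types p q r : seq nat.

Lemma deducible_prefix p u v :
  deducible B u v -> deducible B (prefix_mul p u) (prefix_mul p v).
Proof.
by move=> uv; elim: p => //= i p IHp; apply: ded_mul IHp; apply: ded_refl.
Qed.

Lemma prefix_equiv_refl p : prefix_equiv B p p.
Proof. by move=> w; apply: ded_refl. Qed.

Lemma prefix_equiv_sym p q : prefix_equiv B p q -> prefix_equiv B q p.
Proof. by move=> pq w; apply: ded_sym. Qed.

Lemma prefix_equiv_trans p q r :
  prefix_equiv B p q -> prefix_equiv B q r -> prefix_equiv B p r.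
Proof. by move=> pq qr w; apply: ded_trans (pq w) (qr w). Qed.

Lemma prefix_equiv_cat p q p' q' : prefix_equiv B p q ->
  prefix_equiv B p' q' -> prefix_equiv B (p ++ p') (q ++ q').
Proof.
move=> pq pq' w; rewrite !prefix_mul_cat; apply: ded_trans (pq _) _.
exact: deducible_prefix.
Qed.

Hypothesis swap : forall i j, prefix_equiv B [:: i; j] [:: j; i].

Lemma prefix_equiv_rcons i p : prefix_equiv B (i :: p) (rcons p i).
Proof.
elim: p => [|j p IHp]; first exact: prefix_equiv_refl.
apply: prefix_equiv_trans (prefix_equiv_cat (swap i j) (prefix_equiv_refl p)) _.
exact: (prefix_equiv_cat (prefix_equiv_refl [:: j]) IHp).
Qed.

Lemma perm_prefix_equiv p q : perm_eq p q -> prefix_equiv B p q.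
Proof.
elim: p q => [|i p IHp] q pq.
  by move: pq; rewrite perm_sym => /perm_nilP ->; apply: prefix_equiv_refl.
have iq: i \in q by rewrite -(perm_mem pq) mem_head.
case/splitPr: iq pq => q1 q2 pq.
have {}pq : perm_eq p (q1 ++ q2).
  by rewrite -(perm_cons i) (perm_trans pq) // (perm_catCA q1 [:: i]).
apply: prefix_equiv_trans
  (prefix_equiv_cat (prefix_equiv_refl [:: i]) (IHp _ pq)) _.
rewrite -cat_rcons catA.
exact: prefix_equiv_cat (prefix_equiv_rcons _ _) (prefix_equiv_refl _).
Qed.

Variable n : nat.
Hypothesis insert : forall i, prefix_equiv B [:: i] (nseq n.+1 i).

(** One occurrence of [i] is brought to the front, grown into [n.+1] copies by [insert], and the
    letters are reordered; this is repeated [k] times. *)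
Lemma prefix_equiv_nseq p i k :
  i \in p -> prefix_equiv B p (nseq (k * n)%N i ++ p).
Proof.
move=> ip; elim: k => [|k IHk]; first exact: prefix_equiv_refl.
apply: prefix_equiv_trans IHk _.
have /perm_prefix_equiv : perm_eq (nseq (k * n)%N i ++ p)
    ([:: i] ++ nseq (k * n)%N i ++ rem i p).
  by rewrite perm_sym perm_catCA perm_cat2l perm_sym perm_to_rem.
move/prefix_equiv_trans; apply.
apply: prefix_equiv_trans
  (prefix_equiv_cat (insert i) (prefix_equiv_refl _)) _.
apply: perm_prefix_equiv; rewrite mulSn nseqD -catA /= -cat1s.
rewrite perm_catCA perm_cat2l perm_catCA perm_cat2l perm_sym.
exact: perm_to_rem.
Qed.

Lemma prefix_equiv_flatten (f : nat -> nat) p r : {subset r <= p} ->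
  prefix_equiv B p (flatten [seq nseq (f i * n)%N i | i <- r] ++ p).
Proof.
elim: r => [|i r IHr] rp; first exact: prefix_equiv_refl.
apply: prefix_equiv_trans (prefix_equiv_nseq (f i) (rp i (mem_head _ _))) _.
rewrite /= -catA; apply: prefix_equiv_cat (prefix_equiv_refl _) _.
by apply: IHr => j jr; apply: rp; rewrite inE jr orbT.
Qed.

Lemma count_flatten_nseq (f : nat -> nat) r x : uniq r ->
  count_mem x (flatten [seq nseq (f i) i | i <- r]) = ((x \in r) * f x)%N.
Proof.
elim: r => [//|i r IHr] /= /andP[ir ur].
rewrite count_cat count_nseq IHr // in_cons (eq_sym x i) /=.
by have [<-|_] := eqVneq i x; rewrite ?(negPf ir) /= ?mul1n ?mul0n ?addn0.
Qed.

(** Each side receives, for each of its letters, the other side's count rounded down to a multiple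
    of [n]. Both counts then equal the sum of the two rounded counts plus the common residue, so the
    lists are permutations of each other. *)
Lemma prefix_equiv_count p q : p =i q ->
  (forall x, count_mem x p = count_mem x q %[mod n]) -> prefix_equiv B p q.
Proof.
move=> pq cpq.
have ext r1 r2 : prefix_equiv B r1
    (flatten [seq nseq ((count_mem i r2 %/ n) * n)%N i | i <- undup r1] ++ r1).
  by apply: prefix_equiv_flatten => i; rewrite mem_undup.
apply: prefix_equiv_trans (ext p q) _; apply: prefix_equiv_sym.
apply: prefix_equiv_trans (ext q p) _; apply: perm_prefix_equiv.
apply/allP => x _ /=; rewrite !count_cat !count_flatten_nseq ?undup_uniq //.
rewrite !mem_undup pq; have [xq|xq] := boolP (x \in q); last first.
  by rewrite !(count_memPn _) ?pq.
by apply/eqP; move: (cpq x) (divn_eq (count_mem x p) n)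
  (divn_eq (count_mem x q) n); lia.
Qed.
End PrefixEquivalence.

(** * Completeness of the smaller set of identities *)

Section Completeness.
Variable n : nat.
Hypothesis n_ge2 : 2 <= n.
Local Notation B := (identities_ii n).

(** The substitution for the letters 0, 1, 2, which are [x], [y], [a] in the identities. *)
Let triple (u v w : word) (i : nat) : word :=
  match i with 0 => u | 1 => v | _ => w end.

Lemma identities_ii_swap i j : prefix_equiv B [:: i; j] [:: j; i].
Proof.
move=> w; rewrite /= !mulgA.
have := deducible_instance (triple (letter i) (letter j) w) (identities_ii_3 n).
by rewrite !(@eval_homomorphism word) !eval_letter.
Qed.

Lemma spow_letter i m w : spow (letter i) m.+1 * w = prefix_mul (nseq m.+1 i) w.
Proof. by elim: m => [//|m IHm]; rewrite spowS -mulgA IHm. Qed.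

Lemma identities_ii_insert i : prefix_equiv B [:: i] (nseq n.+1 i).
Proof.
move=> w; apply: ded_sym; rewrite -spow_letter.
have := deducible_instance (triple (letter i) w w) (identities_ii_1 n).
rewrite !(@eval_homomorphism word) !eval_letter.
by rewrite (homomorphism_spow _ _ (@eval_homomorphism word _)) !eval_letter.
Qed.

Lemma identities_ii_squares s t :
  deducible B (prefix_mul [:: t; t; s] (letter s))
              (prefix_mul [:: s; s; t] (letter t)).
Proof.
have := deducible_instance (triple (letter t) (letter s) (letter t))
  (identities_ii_2 n).
by rewrite !(@eval_homomorphism word) !eval_letter -!mulgA.
Qed.

Lemma identities_ii_count p q : p =i q ->
  (forall x, count_mem x p = count_mem x q %[mod n]) -> prefix_equiv B p q.
Proof.
exact: (prefix_equiv_count identities_ii_swap identities_ii_insert).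
Qed.

Lemma identities_ii_complete u v : satisfies J (u, v) ->
  satisfies (Zmod_semigroup n) (u, v) -> deducible B u v.
Proof.
move=> Juv Zuv.
have memE x := satisfies_J_mem x Juv.
have lastE x := satisfies_J_last x Juv.
have countE x := satisfies_Zmod_count x n_ge2 Zuv.
have [p [s uE]] := word_lastP u; have [q [t vE]] := word_lastP v.
move: memE lastE countE; rewrite {}uE {}vE !letters_prefix_mul /= => {u v Juv Zuv}.
move=> memE lastE countE.
have {}memE x : (x \in p) || (x == s) = (x \in q) || (x == t).
  by have := memE x; rewrite !mem_cat !inE.
(* A final letter is the only occurrence of itself exactly when the prefix before it avoids it. *)
have {}lastE x : (x \notin p) && (s == x) = (x \notin q) && (t == x).
  have E r z : (count_mem x (r ++ [:: z]) == 1%N) && (last 0 (r ++ [:: z]) == x) =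
      (x \notin r) && (z == x).
    rewrite last_cat count_cat /= addn0; case: (z =P x) => _; rewrite ?andbF //.
    by rewrite /= addn1 eqSS eqn0Ngt -has_count has_pred1.
  by rewrite -!E.
have {}countE x :
    (count_mem x p + (s == x) = count_mem x q + (t == x) %[mod n])%N.
  by have := countE x; rewrite !count_cat /= !addn0.
have [st|st] := eqVneq s t.
  (* The common last letter cancels from the counts; by [lastE] it lies in both prefixes or in
     neither. *)
  subst t; apply: identities_ii_count => x; last first.
    by apply/eqP; rewrite -(eqn_modDr (s == x)); apply/eqP.
  have := memE x; have := lastE x; rewrite eq_sym.
  by case: eqP; rewrite ?orbF // !andbT => _ /negb_inj.
(* Since [s] and [t] differ, one side of [lastE] is false at each of them. *)
have sp : s \in p.
  by have := lastE s; rewrite eqxx eq_sym (negPf st) andbF andbT => /negbFE.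
have tq : t \in q.
  by have := lastE t; rewrite eqxx (negPf st) andbF andbT => /esym/negbFE.
have tp : t \in p by have := memE t; rewrite eqxx orbT eq_sym (negPf st) orbF.
have sq : s \in q by have := memE s; rewrite eqxx orbT (negPf st) orbF.
(* The exponents make [r ++ [:: t; t; s]] exceed [p] by [2 * n] copies of [t] and [n] of [s], which
   changes no count modulo [n]. *)
pose r := p ++ nseq (2 * n - 2)%N t ++ nseq (n - 1) s.
have rE x : x \in r = (x \in p).
  rewrite !mem_cat !mem_nseq; case: (x =P t) => [->|_]; first by rewrite tp.
  by case: (x =P s) => [->|_]; rewrite ?sp ?andbF ?orbF.
have crE x : count_mem x r =
    (count_mem x p + (t == x) * (2 * n - 2) + (s == x) * (n - 1))%N.
  by rewrite !count_cat !count_nseq addnA.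
have step1 : prefix_equiv B p (r ++ [:: t; t; s]).
  apply: identities_ii_count => x.
    rewrite mem_cat rE !inE; case: (x =P t) => [->|_]; first by rewrite tp.
    by case: (x =P s) => [->|_]; rewrite ?sp ?orbF.
  rewrite count_cat crE /=.
  set c := count_mem x p.
  have -> : (c + (t == x) * (2 * n - 2) + (s == x) * (n - 1) +
    ((t == x) + ((t == x) + ((s == x) + 0))) =
    ((t == x) * 2 + (s == x)) * n + c)%N by case: (t == x); case: (s == x); lia.
  by rewrite modnMDl.
have step2 : prefix_equiv B (r ++ [:: s; s; t]) q.
  apply: identities_ii_count => x.
    rewrite mem_cat rE !inE; case: (x =P t) => [->|/eqP/negPf xt].
      by rewrite tq !orbT.
    case: (x =P s) => [->|/eqP/negPf xs]; first by rewrite sq !orbT.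
    by have := memE x; rewrite xs xt !orbF.
  (* Adding the final [t] to both sides allows [countE] to be used without subtraction. *)
  apply/eqP; rewrite -(eqn_modDr (t == x)) -countE count_cat crE /=.
  set c := count_mem x p.
  have -> : (c + (t == x) * (2 * n - 2) + (s == x) * (n - 1) +
    ((s == x) + ((s == x) + ((t == x) + 0))) + (t == x) =
    ((t == x) * 2 + (s == x)) * n + (c + (s == x)))%N.
    by case: (t == x); case: (s == x); lia.
  by rewrite modnMDl.
(* The chain is [p s], [r t t s s], [r s s t t], [q t]. *)
apply: ded_trans (step1 _) _; apply: ded_trans _ (step2 _).
rewrite !(prefix_mul_cat r); apply: deducible_prefix.
exact: identities_ii_squares.
Qed.
End Completeness.

(** The identity on squares is the case [m1 = m2 = 2]. *)
Lemma identities_ii_sub_i n e : identities_ii n e -> identities_i n e.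
Proof.
by case; [exact: identities_i_1 | exact: identities_i_2 | exact: identities_i_3].
Qed.

Local Close Scope group_scope.

Theorem propositionB15 (n : nat) (n_ge2 : 2 <= n) :
  identity_basis (identities_i n) (var2 J (Zmod_semigroup n)) /\
  identity_basis (identities_ii n) (var2 J (Zmod_semigroup n)).
Proof.
have sound e : identities_i n e ->
    variety_satisfies (var2 J (Zmod_semigroup n)) e.
  move=> Be; apply/var2_satisfies.
  by split; [apply: satisfies_J_identities Be | apply: satisfies_Zmod_identities].
have complete e : variety_satisfies (var2 J (Zmod_semigroup n)) e ->
    deducible (identities_ii n) e.1 e.2.
  by case: e => u v /var2_satisfies[Je Ze]; apply: identities_ii_complete.
(* By this inclusion, soundness of the larger set and completeness of the smaller one give both
   claims. *)
split; split=> [e Be|e Ve].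
- exact: sound.
- exact: deducible_mono (@identities_ii_sub_i n) (complete e Ve).
- exact/sound/identities_ii_sub_i.
- exact: complete.
Qed.
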